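(* Let $d\in\{1,3\}$, let $\mathbb{K}=\mathbb{Q}(\sqrt{-d})\subset\mathbb{C}$ with ring of algebraic integers $\mathcal{O}$, let $\mathcal{A}$ be a central simple algebra over $\mathbb{K}$ isomorphic to $M_2(\mathbb{K})$, let $\Lambda$ be a maximal $\mathcal{O}$-order in $\mathcal{A}$, and let $\phi:\mathcal{A}\to M_2(\mathbb{C})$ be an embedding of $\mathbb{K}$-algebras. If $d=1$, then at least one of the smallest nonzero elements of $\phi(\Lambda)$ with respect to the Frobenius norm has rank one. If $d=3$, then every smallest nonzero element of $\phi(\Lambda)$ with respect to the Frobenius norm has rank one.
   Context: Let $\langle\cdot,\cdot\rangle$ be the standard Hermitian form on $\mathbb{C}^2$. There exist an invertible $P\in M_2(\mathbb{C})$ and a fractional ideal $I$ of $\mathcal{O}$ such that, with $L=P\begin{pmatrix}\mathcal{O}\\ I\end{pmatrix}\subset\mathbb{C}^2$, one has $\phi(\Lambda)=\{A\in M_2(\mathbb{C}):AL\subseteq L\}$. Fix such an $L$ and put $L^*=\{u\in\mathbb{C}^2:\langle u,v\rangle\in\mathcal{O}\text{ for every }v\in L\}$. For $u\in L$, $v\in L^*$ the tensor $u\otimes v$ is identified with the matrix $A_{u,v}$ defined by $A_{u,v}w=\langle v,w\rangle u$ (the form being linear in $w$, so $A_{u,v}=u\bar v^{T}$); under this identification $\phi(\Lambda)$ is the additive group $L\otimes_{\mathcal{O}}L^*$ generated by the $u\otimes v$ with $u\in L$, $v\in L^*$. The rank of a nonzero element $\mathbf x\in\phi(\Lambda)$ is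 the smallest positive integer $r$ such that $\mathbf x=\sum_{i=1}^r\mathbf x_i\otimes\mathbf y_i$ with $\mathbf x_i\in L$, $\mathbf y_i\in L^*$. (When $\mathcal{O}$ is a principal ideal ring, as for $d=1,3$, this coincides with the rank of $\mathbf x$ as a matrix in $M_2(\mathbb{C})$.) The Frobenius norm of a complex matrix is the square root of the sum of the squared absolute values of its entries. *)

(* Defs.v *)
From HB Require Import structures.
From mathcomp Require Import all_boot all_order all_algebra all_field.
From mathcomp Require Import ring.
From mathcomp Require Import boolp classical_sets reals.
From mathcomp Require Export complex.
Set Implicit Arguments.
Unset Strict Implicit.
Unset Printing Implicit Defensive.
Import Order.TTheory GRing.Theory Num.Theory.

Local Open Scope classical_set_scope.
Local Open Scope sesquilinear_scope.
Local Open Scope ring_scope.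

Definition quadratic (R : realType) (d : nat) : {pred R[i]} :=
  fun z => `[< exists a b : rat, z = ratr a + ratr b * sqrtC (- d%:R) >].

Arguments quadratic : clear implicits.

Fact quadratic_divring_closed (R : realType) (d : nat) :
  divring_closed (quadratic R d).
Proof.
pose s : R[i] := sqrtC (- d%:R).
have s2 : s * s = - d%:R by rewrite -expr2 sqrtCK.
have mulP (u v : R[i]) :
    u \in quadratic R d -> v \in quadratic R d -> u * v \in quadratic R d.
  move=> /asboolP[a [b ->]] /asboolP[a' [b' ->]]; apply/asboolP.
  exists (a * a' - b * b' * d%:R), (a * b' + b * a').
  rewrite -/s !(rmorphD, rmorphB, rmorphM, rmorph_nat) /=.
  by ring: s2.
split.
- by apply/asboolP; exists 1, 0; rewrite rmorph1 rmorph0 mul0r addr0.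
- move=> u v /asboolP[a [b ->]] /asboolP[a' [b' ->]]; apply/asboolP.
  exists (a - a'), (b - b').
  by rewrite !rmorphB /= mulrBl opprD addrACA.
- move=> u v Qu /asboolP[a [b Ev]]; apply: mulP => //; apply/asboolP.
  rewrite -/s in Ev *; have [w0|w0] := eqVneq (ratr a - ratr b * s : R[i]) 0.
    exists ((2 * a)^-1), 0.
    rewrite rmorph0 mul0r addr0 fmorphV rmorphM rmorph_nat /=.
    by rewrite Ev -(subr0_eq w0) mulr_natl mulr2n.
  have [v0|v0] := eqVneq v 0.
    by exists 0, 0; rewrite v0 invr0 !rmorph0 mul0r addr0.
  pose n : rat := a * a + b * b * d%:R.
  have En : v * (ratr a - ratr b * s) = ratr n.
    rewrite Ev /n !(rmorphD, rmorphM, rmorph_nat) /=.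
    by ring: s2.
  exists (a / n), (- b / n).
  have -> : v^-1 = (ratr a - ratr b * s) / ratr n.
    by rewrite -En invfM mulrCA mulfV ?mulr1.
  by rewrite !(rmorphM, fmorphV, rmorphN) /=; ring.
Qed.

HB.instance Definition _ (R : realType) (d : nat) :=
  GRing.isDivringClosed.Build R[i] (quadratic R d)
    (quadratic_divring_closed R d).

(* The subfield Q(sqrt(-d)) of the complex numbers, with its inclusion. *)
Record imquad (R : realType) (d : nat) :=
  ImQuad { imquad_val : R[i]; _ : imquad_val \in quadratic R d }.

HB.instance Definition _ (R : realType) (d : nat) :=
  [isSub for @imquad_val R d].
HB.instance Definition _ (R : realType) (d : nat) :=
  [Choice of imquad R d by <:].
HB.instance Definition _ (R : realType) (d : nat) :=
  [SubChoice_isSubIntegralDomain of imquad R d by <:].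
HB.instance Definition _ (R : realType) (d : nat) :=
  [SubIntegralDomain_isSubField of imquad R d by <:].

Definition integers (R : realType) (d : nat) : set (imquad R d) :=
  [set x | integralOver (intr : int -> imquad R d) x].
Arguments integers : clear implicits.

Definition central_simple (K : fieldType) (A : falgType K) : Prop :=
  ('Z({:A}) = 1)%VS /\
  forall I : {vspace A},
    (I * {:A} <= I)%VS -> ({:A} * I <= I)%VS -> I = 0%VS \/ I = fullv.

(* [O] is a subring of [K]; the last two clauses say that [Lambda] is a
   finitely generated [O]-module spanning [A] over [K]. *)
Definition is_order (K : fieldType) (O : set K) (A : falgType K)
    (Lambda : set A) : Prop :=
  [/\ Lambda 1,
      forall x y, Lambda x -> Lambda y -> Lambda (x - y),
      forall x y, Lambda x -> Lambda y -> Lambda (x * y),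
      exists (n : nat) (b : 'I_n -> A),
        Lambda = [set \sum_i c i *: b i | c in [set c : 'I_n -> K |
                                                forall i, O (c i)]]
    & exists s : seq A, (forall x, x \in s -> Lambda x) /\ <<s>>%VS = fullv].

Definition maximal_order (K : fieldType) (O : set K) (A : falgType K)
    (Lambda : set A) : Prop :=
  is_order O Lambda /\
  forall Gamma : set A, is_order O Gamma -> Lambda `<=` Gamma -> Gamma = Lambda.

Definition fractional_ideal (K : fieldType) (O : set K) (I : set K) : Prop :=
  [/\ I 0,
      forall x y, I x -> I y -> I (x + y),
      forall c x, O c -> I x -> I (c * x),
      exists2 x, I x & x != 0
    & exists c, [/\ O c, c != 0 & forall x, I x -> O (c * x)]].

(* Linear in the second variable. *)
Definition herm (R : realType) (u v : 'cV[R[i]]_2) : R[i] :=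
  (u^t* *m v) 0 0.

(* P (O, I)^T; the [seq] lists the two entries of the column. *)
Definition lattice (R : realType) (d : nat) (P : 'M[R[i]]_2)
    (I : set (imquad R d)) : set 'cV[R[i]]_2 :=
  [set w | exists a b : imquad R d, [/\ integers R d a, I b
    & w = P *m \col_(i < 2) [:: imquad_val a; imquad_val b]`_i]].

Definition dual_lattice (R : realType) (d : nat) (L : set 'cV[R[i]]_2) :
    set 'cV[R[i]]_2 :=
  [set u | forall v, L v ->
     (@imquad_val R d @` integers R d) (herm u v)].

Definition tensor (R : realType) (u v : 'cV[R[i]]_2) : 'M[R[i]]_2 :=
  u *m v^t*.

Definition sum_of_tensors (R : realType) (d : nat) (L : set 'cV[R[i]]_2)
    (x : 'M[R[i]]_2) (r : nat) : Prop :=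
  exists u v : 'I_r -> 'cV[R[i]]_2,
    [/\ forall i, L (u i), forall i, dual_lattice d L (v i)
      & x = \sum_i tensor (u i) (v i)].

Definition tensor_rank (R : realType) (d : nat) (L : set 'cV[R[i]]_2)
    (x : 'M[R[i]]_2) (r : nat) : Prop :=
  [/\ (0 < r)%N, sum_of_tensors d L x r
    & forall s, (0 < s)%N -> sum_of_tensors d L x s -> (r <= s)%N].

Definition frobenius (R : realType) (M : 'M[R[i]]_2) : R :=
  Num.sqrt (\sum_i \sum_j Normc.normc (M i j) ^+ 2).

Definition smallest_nonzero (R : realType) (S : set 'M[R[i]]_2)
    (x : 'M[R[i]]_2) : Prop :=
  [/\ S x, x != 0
    & forall y, S y -> y != 0 -> frobenius x <= frobenius y].

(* Main.v *)
Require Import Defs.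
From HB Require Import structures.
From mathcomp Require Import all_boot all_order all_algebra all_field.
From mathcomp Require Import boolp classical_sets reals complex.
From mathcomp Require Import ring lra.
Set Implicit Arguments.
Unset Strict Implicit.
Unset Printing Implicit Defensive.
Import Order.TTheory GRing.Theory Num.Theory.

Local Open Scope classical_set_scope.
Local Open Scope ring_scope.

(* The ring of integers O is Z[i] or Z[w], w = (1 + sqrt(-3)) / 2: every complex
   number is within squared distance rho = 1/2, resp. 1/3, of an element of
   Z[i], resp. Z[w], and a nonzero algebraic integer of K has absolute value at
   least 1, which excludes further integers.  Hence O is Euclidean, I is
   principal and L = Q O^2 with Q invertible, so that the order is
   Q M_2(O) Q^-1.  An element of nonzero determinant has squared norm at least
   2 |det| >= 2, while an element of zero determinant is a pure tensor because
   O is principal.  If u is a shortest vector of L, Hermite's reduction gives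
   ||u||^4 <= |det Q|^2 / (1 - rho), and in dimension 2 the dual lattice is, up
   to conjugation and a rotation, L scaled by 1 / |det Q|; so the shortest pure
   tensor has squared norm ||u||^4 / |det Q|^2 <= 1 / (1 - rho), which is 2 for
   d = 1 and 3/2 < 2 for d = 3. *)

(** * Squared norms and determinants in dimension two *)

Definition normsq (R : rcfType) (z : R[i]) : R := Normc.normc z ^+ 2.

Lemma normsqE (R : rcfType) (z : R[i]) :
  normsq z = complex.Re z ^+ 2 + complex.Im z ^+ 2.
Proof. by case: z => x y; rewrite /normsq sqr_sqrtr ?addr_ge0 ?sqr_ge0. Qed.

Lemma normsq_ge0 (R : rcfType) (z : R[i]) : 0 <= normsq z.
Proof. exact: sqr_ge0. Qed.

Lemma normsqM (R : rcfType) (z w : R[i]) :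
  normsq (z * w) = normsq z * normsq w.
Proof. by rewrite /normsq Normc.normcM exprMn. Qed.

Lemma normsqN (R : rcfType) (z : R[i]) : normsq (- z) = normsq z.
Proof. by rewrite !normsqE !raddfN /= !sqrrN. Qed.

Lemma normsqV (R : rcfType) (z : R[i]) : normsq z^-1 = (normsq z)^-1.
Proof. by rewrite /normsq Normc.normcV exprVn. Qed.

Lemma normsq0 (R : rcfType) : normsq (0 : R[i]) = 0.
Proof. by rewrite /normsq Normc.normc0 expr0n. Qed.

Lemma normsq_eq0 (R : rcfType) (z : R[i]) : (normsq z == 0) = (z == 0).
Proof.
apply/eqP/eqP => [/eqP|->]; last exact: normsq0.
by rewrite sqrf_eq0 => /eqP/Normc.eq0_normc.
Qed.

Lemma normsq_gt0 (R : rcfType) (z : R[i]) : (0 < normsq z) = (z != 0).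
Proof. by rewrite lt0r normsq_ge0 andbT normsq_eq0. Qed.

Lemma normsqJ (R : rcfType) (z : R[i]) : normsq (Num.conj z) = normsq z.
Proof. by case: z => x y; rewrite !normsqE /= sqrrN. Qed.

Lemma normsqC (R : rcfType) (z : R[i]) : (normsq z)%:C%C = z * Num.conj z.
Proof. by case: z => x y; rewrite normsqE /=; simpc; congr Complex; ring. Qed.

Definition vnormsq (R : rcfType) (u : 'cV[R[i]]_2) : R :=
  normsq (u 0 0) + normsq (u 1 0).

(** The determinant of the matrix with columns [u] and [w]. *)
Definition cross (K : comNzRingType) (u w : 'cV[K]_2) : K :=
  u 0 0 * w 1 0 - u 1 0 * w 0 0.

Lemma vnormsq_ge0 (R : rcfType) (u : 'cV[R[i]]_2) : 0 <= vnormsq u.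
Proof. by rewrite addr_ge0 ?normsq_ge0. Qed.

Lemma sum2 (V : nmodType) (F : 'I_2 -> V) : \sum_i F i = F 0 + F 1.
Proof. by rewrite big_ord_recl big_ord1; congr (_ + F _); exact: val_inj. Qed.

Lemma ord2_ind (P : 'I_2 -> Prop) : P 0 -> P 1 -> forall i, P i.
Proof.
move=> P0 P1 [[|[|//]] i2].
  by rewrite (_ : Ordinal i2 = 0) //; exact: val_inj.
by rewrite (_ : Ordinal i2 = 1) //; exact: val_inj.
Qed.

Lemma col2P (T : Type) (u w : 'cV[T]_2) :
  u 0 0 = w 0 0 -> u 1 0 = w 1 0 -> u = w.
Proof.
by move=> h0 h1; apply/matrixP => i j; rewrite (ord1 j); elim/ord2_ind: i.
Qed.

Lemma vnormsq_eq0 (R : rcfType) (u : 'cV[R[i]]_2) : (vnormsq u == 0) = (u == 0).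
Proof.
rewrite paddr_eq0 ?normsq_ge0 // !normsq_eq0.
apply/andP/eqP => [[/eqP h0 /eqP h1]|->]; last by rewrite !mxE.
by apply: col2P; rewrite ?h0 ?h1 mxE.
Qed.

Lemma hermE (R : realType) (u w : 'cV[R[i]]_2) :
  herm u w = Num.conj (u 0 0) * w 0 0 + Num.conj (u 1 0) * w 1 0.
Proof. by rewrite /herm mxE sum2 !mxE. Qed.

(** Lagrange's identity, a polynomial identity in real and imaginary parts. It yields
    Cauchy-Schwarz, Hadamard's inequality and Hermite's bound below. *)
Lemma lagrange (R : realType) (u w : 'cV[R[i]]_2) :
  vnormsq u * vnormsq w = normsq (cross u w) + normsq (herm u w).
Proof.
rewrite hermE /vnormsq /cross !normsqE.
case: (u 0 0) (u 1 0) (w 0 0) (w 1 0) => [a b] [c e] [f g] [h k] /=.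
by simpc => /=; ring.
Qed.

Lemma cross_mulmx (K : comNzRingType) (Q : 'M[K]_2) (a b : 'cV[K]_2) :
  cross (Q *m a) (Q *m b) = \det Q * cross a b.
Proof.
rewrite /cross (expand_det_row _ 0) sum2 !mxE !sum2 /cofactor !det_mx11 !mxE /=.
rewrite expr0 mul1r.
have -> : lift (0 : 'I_2) (0 : 'I_1) = 1 by exact: val_inj.
have -> : lift (1 : 'I_2) (0 : 'I_1) = 0 by exact: val_inj.
by ring.
Qed.

(** * Norm-Euclidean discrete subrings of the complex numbers *)

(** The common interface to the Gaussian and Eisenstein integers. Here [rho] bounds the squared
    covering radius, [euclid_cover] serves as division with remainder, and [euclid_finite] makes
    minima exist. *)
Record euclidean (R : realType) (O : set R[i]) (rho : R) : Prop := Euclidean {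
  euclid1 : O 1;
  euclidB : forall z w, O z -> O w -> O (z - w);
  euclidM : forall z w, O z -> O w -> O (z * w);
  euclid_ge1 : forall z, O z -> z != 0 -> 1 <= normsq z;
  euclid_finite : forall B : R,
    exists s : seq R[i], forall z, O z -> normsq z <= B -> z \in s;
  euclid_lt1 : rho < 1;
  euclid_cover : forall z, exists2 t, O t & normsq (z - t) <= rho }.

Lemma euclid0 (R : realType) (O : set R[i]) rho : euclidean O rho -> O 0.
Proof.
by move=> E; rewrite -(subrr 1); apply: (euclidB E); exact: euclid1 E.
Qed.

Lemma euclidN (R : realType) (O : set R[i]) rho z :
  euclidean O rho -> O z -> O (- z).
Proof.
by move=> E Oz; rewrite -sub0r; apply: (euclidB E) => //; exact: euclid0 E.
Qed.

Lemma euclidD (R : realType) (O : set R[i]) rho z w :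
  euclidean O rho -> O z -> O w -> O (z + w).
Proof.
move=> E Oz Ow; rewrite -[w]opprK.
by apply: (euclidB E) => //; exact: (euclidN E).
Qed.

(** Induction on the list enclosing the sublevel set of [x0]: its head is minimal, or lies outside
    that set, or is strictly beaten by some [b] satisfying [P] and drops out on restarting from
    [b]. *)
Lemma finite_sublevel_min (R : realDomainType) (T : eqType) (P : T -> Prop)
    (f : T -> R) (x0 : T) (s : seq T) :
  P x0 -> (forall y, P y -> f y <= f x0 -> y \in s) ->
  exists2 x, P x & forall y, P y -> f x <= f y.
Proof.
elim: s x0 => [|a s IHs] x0 Px0 Hs; first by have := Hs _ Px0 (lexx _).
have [[Pa le_a]|nPa] := pselect (P a /\ f a <= f x0); last first.
  apply: IHs Px0 _ => y Py le_y; have := Hs y Py le_y.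
  by rewrite inE => /predU1P[Ey|//]; case: nPa; rewrite -Ey.
have [[b [Pb lt_b]]|min_a] := pselect (exists b, P b /\ f b < f a).
  apply: IHs Pb _ => y Py le_y.
  have := Hs y Py (le_trans le_y (ltW (lt_le_trans lt_b le_a))).
  by rewrite inE => /predU1P[Ey|//]; rewrite Ey leNgt lt_b in le_y.
exists a => // y Py; rewrite leNgt; apply/negP => lt_y.
by apply: min_a; exists y.
Qed.

(** A nonzero [g] in [J] with [c * g] of least norm generates, since the remainder of any [x] modulo
    [g] is smaller. The denominator [c] lets the lemma cover fractional ideals as well as ideals of
    [O], where [c = 1]. *)
Lemma euclidean_principal (R : realType) (O : set R[i]) rho (J : set R[i]) c :
  euclidean O rho ->
  (forall x y, J x -> J y -> J (x + y)) ->
  (forall a x, O a -> J x -> J (a * x)) ->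
  (exists2 x, J x & x != 0) -> c != 0 -> (forall x, J x -> O (c * x)) ->
  exists g, [/\ J g, g != 0 & forall x, J x -> exists2 a, O a & x = a * g].
Proof.
move=> E JD JM [x0 Jx0 x0N0] cN0 Jc.
have [s Hs] := euclid_finite E (normsq (c * x0)).
have [|x [Jx xN0] le_x|g [Jg gN0] min_g] := @finite_sublevel_min _ _
    (fun x => J x /\ x != 0) (fun x => normsq (c * x)) x0 [seq z / c | z <- s].
- by [].
- move: (Hs _ (Jc _ Jx) le_x) => /(map_f (fun z => z / c)).
  by rewrite mulrAC mulfV // mul1r.
exists g; split => // x Jx.
have [t Ot le_t] := euclid_cover E (x / g); exists t => //.
have Jr : J (x + - t * g).
  by apply: JD => //; apply: JM => //; exact: (euclidN E).
have [/eqP|rN0] := eqVneq (x + - t * g) 0.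
  by rewrite addr_eq0 mulNr opprK => /eqP.
have := min_g _ (conj Jr rN0); rewrite !normsqM ler_pM2l ?normsq_gt0 //.
have -> : x + - t * g = (x / g - t) * g by rewrite mulrBl divfK // mulNr.
rewrite normsqM ler_pMl ?normsq_gt0 // => le1.
by have := lt_le_trans (euclid_lt1 E) (le_trans le1 le_t); rewrite ltxx.
Qed.

Lemma euclidean_bezout (R : realType) (O : set R[i]) rho a b :
  euclidean O rho -> O a -> O b -> (a != 0) || (b != 0) ->
  exists g a' b' x y, [/\ O g, O a', O b' & O x] /\
    [/\ O y, g != 0, a = g * a', b = g * b' & x * a' + y * b' = 1].
Proof.
move=> E Oa Ob ab0.
pose J : set R[i] := [set z | exists x y, [/\ O x, O y & z = x * a + y * b]].
have O0 := euclid0 E; have O1 := euclid1 E.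
have Ja : J a by exists 1, 0; rewrite mul1r mul0r addr0.
have Jb : J b by exists 0, 1; rewrite mul1r mul0r add0r.
have [||||x|g [[x [y [Ox Oy gE]]] g0 gP]] := @euclidean_principal _ O rho J 1 E.
- move=> _ _ [x [y [Ox Oy ->]]] [z [t [Oz Ot ->]]].
  by exists (x + z), (y + t); split; [exact: (euclidD E)..|ring].
- move=> c _ Oc [x [y [Ox Oy ->]]].
  by exists (c * x), (c * y); split; [exact: (euclidM E)..|ring].
- by case/orP: ab0; [exists a | exists b].
- exact: oner_neq0.
- move=> [z [t [Oz Ot ->]]]; rewrite mul1r.
  by apply: (euclidD E); apply: (euclidM E).
have [a' Oa' aE] := gP _ Ja; have [b' Ob' bE] := gP _ Jb.
exists g, a', b', x, y; split; split => //; rewrite 1?mulrC //.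
- by rewrite gE; apply: (euclidD E); apply: (euclidM E).
- by apply: (mulIf g0); rewrite mul1r [RHS]gE aE bE; ring.
Qed.

(** * Shortest vectors and Hermite's bound *)

Definition intvec (R : realType) (O : set R[i]) : set 'cV[R[i]]_2 :=
  [set a | forall i, O (a i 0)].

(** The quarter turn that converts the bilinear dot product into [cross]; it identifies a rank-two
    lattice with its dual up to scaling and conjugation. *)
Definition perp (K : pzRingType) (a : 'cV[K]_2) : 'cV[K]_2 :=
  \col_i [:: a 1 0; - a 0 0]`_i.

Lemma perpK (K : pzRingType) (a : 'cV[K]_2) : perp (perp a) = - a.
Proof. by apply: col2P; rewrite !mxE /= ?mxE. Qed.

Lemma perp_eq0 (K : pzRingType) (a : 'cV[K]_2) : (perp a == 0) = (a == 0).
Proof.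
apply/eqP/eqP => [a0|->]; last by apply: col2P; rewrite !mxE /= ?oppr0.
apply: oppr_inj; rewrite -[LHS]perpK a0.
by apply: col2P; rewrite !mxE /= ?mxE ?oppr0.
Qed.

Lemma intvec_perp (R : realType) (O : set R[i]) rho a :
  euclidean O rho -> intvec O a -> intvec O (perp a).
Proof.
by move=> E Oa; elim/ord2_ind; rewrite mxE //=; exact: (euclidN E).
Qed.

Lemma trmx_mul_cross (K : comNzRingType) (b e : 'cV[K]_2) :
  (b^T *m e) 0 0 = cross (perp b) e.
Proof. by rewrite mxE sum2 /cross !mxE /=; ring. Qed.

Lemma normsq_herm_le (R : realType) (u w : 'cV[R[i]]_2) :
  normsq (herm u w) <= vnormsq u * vnormsq w.
Proof. by rewrite lagrange lerDr normsq_ge0. Qed.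

Lemma normsq_coord_le (R : realType) (u : 'cV[R[i]]_2) i :
  normsq (u i 0) <= vnormsq u.
Proof.
by elim/ord2_ind: i; rewrite /vnormsq ?lerDl ?lerDr normsq_ge0.
Qed.

(** Cauchy-Schwarz on each row of [M]; the rows are conjugated because [herm] is conjugate-linear in
    its first argument. *)
Lemma vnormsq_mulmx_le (R : realType) (M : 'M[R[i]]_2) :
  exists2 K : R, 0 <= K & forall u, vnormsq (M *m u) <= K * vnormsq u.
Proof.
pose r i := \col_j Num.conj (M i j).
have coordE i u : (M *m u) i 0 = herm (r i) u.
  by rewrite hermE !mxE sum2 !conjCK.
exists (vnormsq (r 0) + vnormsq (r 1)) => [|u].
  by rewrite addr_ge0 ?vnormsq_ge0.
by rewrite {1}/vnormsq !coordE mulrDl lerD ?normsq_herm_le.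
Qed.

Lemma intvec_finite (R : realType) (O : set R[i]) rho (B : R) :
  euclidean O rho ->
  exists s : seq 'cV[R[i]]_2, forall a, intvec O a -> vnormsq a <= B -> a \in s.
Proof.
move=> E; have [s Hs] := euclid_finite E B.
exists [seq \col_i [:: x; y]`_i | x <- s, y <- s] => a Oa leB.
have -> : a = \col_i [:: a 0 0; a 1 0]`_i by apply: col2P; rewrite mxE.
by apply: allpairs_f; apply: Hs => //;
  apply: le_trans leB; exact: normsq_coord_le.
Qed.

(** Boundedness of [invmx Q] turns a bound on [Q *m a] into a bound on [a], which leaves finitely
    many integral candidates. The all-ones vector starts the search. *)
Lemma shortest_vector (R : realType) (O : set R[i]) rho (Q : 'M[R[i]]_2) :
  euclidean O rho -> Q \in unitmx ->
  exists a, [/\ intvec O a, a != 0 &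
    forall b, intvec O b -> b != 0 -> vnormsq (Q *m a) <= vnormsq (Q *m b)].
Proof.
move=> E Qu; pose e : 'cV[R[i]]_2 := const_mx 1.
have [K K0 HK] := vnormsq_mulmx_le (invmx Q).
have [s Hs] := intvec_finite (K * vnormsq (Q *m e)) E.
have [|x [Ox x0] le_x|a [Oa a0] min_a] := @finite_sublevel_min _ _
    (fun x => intvec O x /\ x != 0) (fun x => vnormsq (Q *m x)) e s.
- split=> [i|]; first by rewrite mxE; exact: euclid1 E.
  by apply/eqP => /matrixP/(_ 0 0)/eqP; rewrite !mxE oner_eq0.
- apply: Hs => //; rewrite -[x](mulKmx Qu).
  by apply: le_trans (HK _) _; rewrite ler_wpM2l.
by exists a; split=> // b Ob b0; apply: min_a.
Qed.

Lemma unitmx_mul_eq0 (K : comUnitRingType) n m (Q : 'M[K]_n) (b : 'M_(n, m)) :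
  Q \in unitmx -> (Q *m b == 0) = (b == 0).
Proof.
move=> Qu; apply/eqP/eqP => [b0|->]; last exact: mulmx0.
by rewrite -[b](mulKmx Qu) b0 mulmx0.
Qed.

(* Reducing a second basis vector w modulo the shortest one u makes
   |<u, w>|^2 <= rho ||u||^4 while keeping cross u w fixed. *)
Lemma shortest_vector_le (R : realType) (O : set R[i]) rho (Q : 'M[R[i]]_2) a :
  euclidean O rho -> Q \in unitmx -> intvec O a -> a != 0 ->
  (forall b, intvec O b -> b != 0 -> vnormsq (Q *m a) <= vnormsq (Q *m b)) ->
  vnormsq (Q *m a) ^+ 2 * (1 - rho) <= normsq (\det Q).
Proof.
move=> E Qu Oa a0 min_a; set u := Q *m a.
have u_gt0 : 0 < vnormsq u.
  by rewrite lt0r vnormsq_ge0 vnormsq_eq0 (unitmx_mul_eq0 _ Qu) a0.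
have ab0 : (a 0 0 != 0) || (a 1 0 != 0).
  rewrite -negb_and; apply: contra a0 => /andP[/eqP h0 /eqP h1].
  by apply/eqP/col2P; rewrite mxE.
have [g [p [q [x [y [[Og Op Oq Ox] [Oy g0 pE qE bez]]]]]]] :=
  euclidean_bezout E (Oa 0) (Oa 1) ab0.
(* The Bezout coefficients supply an integral partner of [a] whose determinant with [a] is the gcd
   [g] of the entries of [a]. *)
pose b : 'cV[R[i]]_2 := \col_i [:: - y; x]`_i.
have crossab : cross a b = g.
  by rewrite /cross !mxE /= pE qE -[RHS]mulr1 -bez; ring.
pose a' : 'cV[R[i]]_2 := \col_i [:: p; q]`_i.
have aE : a = g *: a' by apply: col2P; rewrite !mxE /=.
have a'0 : a' != 0 by apply: contra a0 => /eqP a'0; rewrite aE a'0 scaler0.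
have vZ c (v : 'cV[R[i]]_2) : vnormsq (c *: v) = normsq c * vnormsq v.
  by rewrite /vnormsq !mxE !normsqM mulrDr.
have Oa' : intvec O a' by elim/ord2_ind; rewrite mxE.
(* As [a = g *: a'] with [a'] integral and nonzero, a larger [g] would make [Q *m a'] shorter than
   [u]. *)
have g1 : normsq g <= 1.
  have := min_a _ Oa' a'0; rewrite -/u => le_u.
  have u'0 : 0 < vnormsq (Q *m a').
    by rewrite lt0r vnormsq_ge0 vnormsq_eq0 (unitmx_mul_eq0 _ Qu) a'0.
  by rewrite -(ler_pM2r u'0) mul1r -vZ scalemxAr -aE.
have [t Ot le_t] := euclid_cover E (herm u (Q *m b) / (vnormsq u)%:C%C).
pose c := b - t *: a.
have crossac : cross a c = g.
  by rewrite -crossab /cross !mxE; ring.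
have Oc : intvec O c.
  move=> i; rewrite !mxE; apply: (euclidB E); last exact: (euclidM E).
  by elim/ord2_ind: i => //=; exact: (euclidN E).
have c0 : c != 0.
  apply: contra g0 => /eqP c0; rewrite -crossac c0 /cross !mxE.
  by apply/eqP; ring.
have hermc : herm u (Q *m c) =
    (vnormsq u)%:C%C * (herm u (Q *m b) / (vnormsq u)%:C%C - t).
  have uu : herm u u = (vnormsq u)%:C%C.
    by rewrite hermE /vnormsq rmorphD /= !normsqC; congr (_ + _); rewrite mulrC.
  rewrite mulrBr mulrC divfK; last by rewrite fmorph_eq0 gt_eqF.
  rewrite -uu /c mulmxBr -scalemxAr -/u !hermE !mxE; ring.
have nC (k : R) : normsq k%:C%C = k ^+ 2 by rewrite normsqE /= expr0n addr0.
have := lagrange u (Q *m c).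
rewrite cross_mulmx crossac hermc !normsqM nC => Elag.
have le1 : vnormsq u ^+ 2 <= vnormsq u * vnormsq (Q *m c).
  by rewrite expr2 ler_pM2l // min_a.
have le2 : normsq (\det Q) * normsq g <= normsq (\det Q).
  by rewrite ler_piMr ?normsq_ge0.
rewrite mulrBr mulr1 lerBlDr; apply: le_trans le1 _; rewrite Elag lerD //.
by rewrite ler_wpM2l ?sqr_ge0.
Qed.

(** * Dual vectors, the Frobenius norm and rank-one matrices *)

(** The conjugation cancels those in [herm] and [tensor], so that pairing with [Q *m a] becomes the
    plain dot product of [b] and [a]. *)
Definition dualvec (R : realType) (Q : 'M[R[i]]_2) (b : 'cV[R[i]]_2) :=
  map_mx Num.conj (b^T *m invmx Q)^T.

Lemma tensor_dualvec (R : realType) (Q : 'M[R[i]]_2) (u b : 'cV[R[i]]_2) :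
  tensor u (dualvec Q b) = u *m b^T *m invmx Q.
Proof.
rewrite /tensor /dualvec -mulmxA; congr (_ *m _); apply/matrixP => i j.
by rewrite !mxE conjCK.
Qed.

Lemma herm_dualvec (R : realType) (Q : 'M[R[i]]_2) (a b : 'cV[R[i]]_2) :
  Q \in unitmx -> herm (dualvec Q b) (Q *m a) = (b^T *m a) 0 0.
Proof.
move=> Qu; have -> : b^T *m a = b^T *m invmx Q *m (Q *m a).
  by rewrite -mulmxA mulKmx.
rewrite /herm; congr ((_ *m _) 0 0).
by apply/matrixP => i j; rewrite !mxE conjCK.
Qed.

(** By [cross_mulmx], the entries of [b^T *m invmx Q] are those of [Q *m perp b] divided by
    [\det Q], up to order and sign. *)
Lemma vnormsq_dualvec (R : realType) (Q : 'M[R[i]]_2) (b : 'cV[R[i]]_2) :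
  Q \in unitmx ->
  vnormsq (dualvec Q b) = vnormsq (Q *m perp b) / normsq (\det Q).
Proof.
move=> Qu; set w := Q *m perp b.
have coordE e : (b^T *m invmx Q *m e) 0 0 = (\det Q)^-1 * cross w e.
  by rewrite -mulmxA trmx_mul_cross -[perp b](mulKmx Qu) cross_mulmx det_inv.
have rE j : (b^T *m invmx Q) 0 j = (\det Q)^-1 * cross w (delta_mx j 0).
  by rewrite -coordE -colE [RHS]mxE.
have vE j : normsq (dualvec Q b j 0) = normsq ((b^T *m invmx Q) 0 j).
  by rewrite mxE normsqJ mxE.
rewrite /vnormsq !vE !rE /cross !mxE /= !normsqM.
by rewrite !mulr0 !mulr1 sub0r subr0 normsqN normsqV; ring.
Qed.

Definition frobsq (R : realType) (M : 'M[R[i]]_2) : R :=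
  vnormsq (col 0 M) + vnormsq (col 1 M).

Lemma frobeniusE (R : realType) (M : 'M[R[i]]_2) :
  frobenius M = Num.sqrt (frobsq M).
Proof.
by rewrite /frobenius !sum2 /frobsq /vnormsq !mxE /normsq; congr Num.sqrt; ring.
Qed.

Lemma le_frobenius (R : realType) (M N : 'M[R[i]]_2) :
  (frobenius M <= frobenius N) = (frobsq M <= frobsq N).
Proof. by rewrite !frobeniusE ler_sqrt // addr_ge0 ?vnormsq_ge0. Qed.

Lemma frobsq_tensor (R : realType) (u v : 'cV[R[i]]_2) :
  frobsq (tensor u v) = vnormsq u * vnormsq v.
Proof.
rewrite /frobsq /tensor /vnormsq !mxE !big_ord1 !mxE !normsqM !normsqJ.
ring.
Qed.

Lemma det2E (K : comNzRingType) (M : 'M[K]_2) :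
  \det M = M 0 0 * M 1 1 - M 0 1 * M 1 0.
Proof.
rewrite -[LHS]mulr1; have <- : cross (delta_mx 0 0) (delta_mx 1 0) = 1 :> K.
  by rewrite /cross !mxE /= mulr0 subr0 mulr1.
by rewrite -cross_mulmx -!colE /cross !mxE; ring.
Qed.

(** Hadamard's inequality bounds the product of the squared column norms below by 1, and the
    arithmetic-geometric mean inequality bounds their sum. *)
Lemma frobsq_ge2 (R : realType) (M : 'M[R[i]]_2) :
  1 <= normsq (\det M) -> 2 <= frobsq M.
Proof.
move=> le1; have := lagrange (col 0 M) (col 1 M).
have -> : cross (col 0 M) (col 1 M) = \det M by rewrite det2E /cross !mxE; ring.
rewrite /frobsq; move: (normsq_ge0 (herm (col 0 M) (col 1 M))).
move: (vnormsq_ge0 (col 0 M)) (vnormsq_ge0 (col 1 M)).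
set p := vnormsq _; set q := vnormsq _ => p0 q0 h0 pqE.
have pq1 : 1 <= p * q by rewrite pqE -[1]addr0 lerD.
rewrite -(@ler_pXn2r _ 2) ?nnegrE ?ler0n ?(addr_ge0 p0 q0) //.
by have := sqr_ge0 (p - q); lra.
Qed.

(** If the first column is nonzero, it is [g] times a coprime pair [(p, q)]. The vanishing
    determinant makes the second column a multiple of [(p, q)], and the Bezout relation exhibits the
    multiplier as an element of [O]. *)
Lemma integral_rank1 (R : realType) (O : set R[i]) rho (M : 'M[R[i]]_2) :
  euclidean O rho -> (forall i j, O (M i j)) -> \det M = 0 ->
  exists a b, [/\ intvec O a, intvec O b & M = a *m b^T].
Proof.
move=> E OM; rewrite det2E => /eqP; rewrite subr_eq0 => /eqP detM.
have mk f g : O f -> O g -> intvec O (\col_i [:: f; g]`_i).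
  by move=> Of Og; elim/ord2_ind; rewrite mxE.
have mx2P (N : 'M[R[i]]_2) : M 0 0 = N 0 0 -> M 1 0 = N 1 0 ->
    M 0 1 = N 0 1 -> M 1 1 = N 1 1 -> M = N.
  move=> h00 h10 h01 h11; apply/matrixP => i j.
  by elim/ord2_ind: i; elim/ord2_ind: j.
have [/andP[/eqP M00 /eqP M10]|M0] := boolP ((M 0 0 == 0) && (M 1 0 == 0)).
  exists (col 1 M), (\col_i [:: 0; 1]`_i); split.
  - by move=> i; rewrite mxE.
  - by apply: mk; [exact: euclid0 E | exact: euclid1 E].
  - by apply: mx2P; rewrite !mxE big_ord1 !mxE /= ?M00 ?M10; ring.
rewrite negb_and in M0.
have [g [p [q [x [y [[Og Op Oq Ox] [Oy g0 pE qE bez]]]]]]] :=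
  euclidean_bezout E (OM 0 0) (OM 1 0) M0.
exists (\col_i [:: p; q]`_i), (\col_i [:: g; x * M 0 1 + y * M 1 1]`_i).
have O' : O (x * M 0 1 + y * M 1 1) by apply: (euclidD E); apply: (euclidM E).
split; [exact: mk | exact: mk |].
have det' : p * M 1 1 = q * M 0 1.
  by apply: (mulfI g0); rewrite !mulrA -pE -qE detM mulrC.
apply: mx2P; rewrite !mxE big_ord1 !mxE /=.
- by rewrite mulrC.
- by rewrite mulrC.
- by rewrite mulrDr (mulrCA p y) det' -[LHS]mul1r -bez; ring.
- by rewrite mulrDr (mulrCA q x) -det' -[LHS]mul1r -bez; ring.
Qed.

(** * Norms of quadratic integers and covering by lattices *)

Lemma rat_integral_int (q : rat) :
  integralOver (intr : int -> rat) q -> q \is a Num.int.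
Proof.
move=> [p p_monic p_root].
have : (ratr q : algC) \in Num.int.
  apply: Cint_rat_Aint; first by apply/CratP; exists q.
  apply: (@root_monic_Aint (map_poly intr p)).
  - move: p_root; rewrite -(fmorph_root (ratr : rat -> algC)) -map_poly_comp.
    by rewrite (eq_map_poly (fun=> ratr_int _ _)).
  - exact: monic_map.
  - by apply/polyOverP => i; rewrite coef_map /= intr_int.
move=> /intrP[m /eqP]; rewrite -(ratr_int algC) fmorph_eq => /eqP ->.
exact: intr_int.
Qed.

Lemma sqrtCN_natr (R : realType) (d : nat) : (0 < d)%N ->
  exists2 y : R, sqrtC (- d%:R) = (0 +i* y)%C & y ^+ 2 = d%:R.
Proof.
move=> d_gt0; have d0 : 0 < d%:R :> R by rewrite ltr0n.
have := sqrtCK (- d%:R : R[i]).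
case: (sqrtC _) => x y; rewrite expr2.
have -> : (d%:R : R[i]) = (d%:R +i* 0)%C.
  by rewrite -(rmorph_nat (real_complex R)).
simpc => -[E1 E2]; suff x0 : x = 0.
  by exists y; rewrite ?x0 //; move: E1; rewrite x0; lra.
apply/eqP; apply: contraT => x0.
have y0 : y = 0 by apply: (mulfI x0); rewrite mulr0; lra.
by have := sqr_ge0 x; move: E1; rewrite y0 expr2; lra.
Qed.

(** The product of [z] and its conjugate is integral over the integers, and it equals the rational
    number [a ^+ 2 + d%:R * b ^+ 2]. *)
Lemma normsq_integer (R : realType) (d : nat) (z : R[i]) : (0 < d)%N ->
  (@imquad_val R d @` integers R d) z -> exists n : int, normsq z = n%:~R.
Proof.
move=> d_gt0 [x intx <-].
have int_val : integralOver (intr : int -> R[i]) (imquad_val x).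
  have [p p_monic p_root] := intx; exists p => //.
  move: p_root; rewrite -(fmorph_root (\val : imquad R d -> R[i])).
  rewrite -map_poly_comp.
  by rewrite (eq_map_poly (fun=> rmorph_int _ _)).
have int_conj : integralOver (intr : int -> R[i]) (Num.conj (imquad_val x)).
  have [p p_monic p_root] := int_val; exists p => //.
  move: p_root; rewrite -(fmorph_root (@Num.conj R[i])) -map_poly_comp.
  by rewrite (eq_map_poly (fun=> rmorph_int _ _)).
have := integral_mul int_val int_conj.
have [y sE y2] := sqrtCN_natr R d_gt0.
have /asboolP[a [b xE]] := valP x.
have normE : imquad_val x * Num.conj (imquad_val x) =
    ratr (a ^+ 2 + d%:R * b ^+ 2).
  rewrite [imquad_val x]xE rmorphD /= [Num.conj (ratr b * _)]rmorphM /=.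
  rewrite !fmorph_rat.
  have -> : Num.conj (sqrtC (- d%:R : R[i])) = - sqrtC (- d%:R).
    by rewrite sE /=; simpc.
  rewrite rmorphD rmorphM !rmorphXn rmorph_nat /=.
  by have := sqrtCK (- d%:R : R[i]); set s := sqrtC _ => s2; ring: s2.
rewrite normE => -[p p_monic p_root].
have /rat_integral_int/intrP[n qE] :
    integralOver (intr : int -> rat) (a ^+ 2 + d%:R * b ^+ 2).
  exists p => //; move: p_root.
  rewrite -(fmorph_root (ratr : rat -> R[i])) -map_poly_comp.
  by rewrite -(@eq_map_poly _ _ _ _ (fun=> ratr_int _ _)).
exists n; apply: (@complexI R).
by rewrite normsqC normE qE ratr_int rmorph_int.
Qed.

Lemma int_sqr_finite (R : archiRealDomainType) (B : R) :
  exists s : seq int, forall m : int, m%:~R ^+ 2 <= B -> m \in s.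
Proof.
pose K := Num.bound `|B|.
exists ([seq n%:Z | n <- iota 0 K] ++ [seq - n%:Z | n <- iota 0 K]) => m leB.
have sqrE : m%:~R ^+ 2 = (`|m| ^ 2)%N%:R :> R.
  by rewrite natrX natr_absz intr_norm real_normK ?num_real.
have lt_m : (`|m| < K)%N.
  have : (`|m| ^ 2 < K)%N.
    rewrite -(ltr_nat R) -sqrE; apply: le_lt_trans leB _.
    exact: le_lt_trans (ler_norm B) (archi_boundP (normr_ge0 _)).
  by apply: leq_ltn_trans; rewrite -mulnn; case: `|m|%N => // n;
    rewrite leq_pmulr.
rewrite mem_cat; case: m {leB sqrE} lt_m => n lt_n.
  by apply/orP; left; apply/mapP; exists n; rewrite ?mem_iota.
by apply/orP; right; apply/mapP; exists n.+1; rewrite ?mem_iota ?NegzE.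
Qed.

Lemma int_near (R : archiRealFieldType) (x : R) :
  exists m : int, (x - m%:~R) ^+ 2 <= 1 / 4.
Proof.
have := floor_itv (x + 1 / 2); set m := Num.floor _.
rewrite rmorphD /= => /andP[h1 h2]; exists m; nra.
Qed.

(** The lattice spanned by 1 and [k + i h] exhausts [O]: an element of [O] differs from a nearby
    lattice point by an element of integral norm at most [rho < 1], hence by 0. Finiteness then
    reduces to bounding two integer coordinates. *)
Lemma quadratic_lattice_euclidean (R : realType) (O : set R[i]) (rho k h : R) :
  h != 0 -> rho < 1 -> O 1 -> O (k +i* h)%C ->
  (forall z w, O z -> O w -> O (z - w)) ->
  (forall z w, O z -> O w -> O (z * w)) ->
  (forall z, O z -> exists n : int, normsq z = n%:~R) ->
  (forall z, exists m n : int,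
     normsq (z - (m%:~R + n%:~R * (k +i* h)%C)) <= rho) ->
  euclidean O rho.
Proof.
move=> h0 rho1 O1 Ot OB OM Onorm cover.
have O0 : O 0 by rewrite -(subrr 1); apply: OB.
have OD z w : O z -> O w -> O (z + w).
  move=> Oz Ow; rewrite -[w]opprK -[- w]sub0r.
  by apply: (OB) => //; exact: OB.
have Oint (m : int) : O m%:~R.
  have On (n : nat) : O n%:R by elim: n => // n IHn; rewrite -natr1; apply: OD.
  case: m => n; first exact: On.
  by rewrite NegzE rmorphN -sub0r; apply: OB => //; exact: On.
have Ocomb (m n : int) : O (m%:~R + n%:~R * (k +i* h)%C).
  by apply: OD => //; apply: OM.
have ge1 z : O z -> z != 0 -> 1 <= normsq z.
  move=> /Onorm[n nE]; rewrite -normsq_gt0 nE ltr0z => n0.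
  by rewrite -[1]/(1%:~R) ler_int.
have OE z : O z -> exists m n : int, z = m%:~R + n%:~R * (k +i* h)%C.
  move=> Oz; have [m [n le_rho]] := cover z; exists m, n.
  apply/eqP; rewrite -subr_eq0; apply: contraT => z0.
  have := ge1 _ (OB _ _ Oz (Ocomb m n)) z0.
  by move=> /le_trans/(_ le_rho)/le_lt_trans/(_ rho1); rewrite ltxx.
split=> // [B|z]; last first.
  by have [m [n le_rho]] := cover z; exists (m%:~R + n%:~R * (k +i* h)%C).
have [s Hs] := int_sqr_finite (2 * B + 2 * k ^+ 2 * (B / h ^+ 2)).
have [s' Hs'] := int_sqr_finite (B / h ^+ 2).
exists [seq m%:~R + n%:~R * (k +i* h)%C | m <- s, n <- s'] => z Oz leB.
have [m [n zE]] := OE z Oz; rewrite zE in leB *.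
have nE : normsq (m%:~R + n%:~R * (k +i* h)%C) =
    (m%:~R + n%:~R * k) ^+ 2 + (n%:~R * h) ^+ 2.
  have toC (j : int) : (j%:~R : R[i]) = (j%:~R +i* 0)%C.
    by rewrite -(rmorph_int (real_complex R)).
  by rewrite normsqE !toC; simpc => /=; ring.
rewrite nE in leB.
have leN : n%:~R ^+ 2 <= B / h ^+ 2.
  rewrite ler_pdivlMr ?exprn_even_gt0 //.
  by move: (sqr_ge0 (m%:~R + n%:~R * k)); lra.
have leM : m%:~R ^+ 2 <= 2 * B + 2 * k ^+ 2 * (B / h ^+ 2).
  have := ler_wpM2l (sqr_ge0 k) leN.
  (* The first square rearranges to [m^2 <= 2 (m + n k)^2 + 2 (n k)^2]. *)
  have := sqr_ge0 (m%:~R + 2 * n%:~R * k); have := sqr_ge0 (n%:~R * h).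
  lra.
by apply: allpairs_f; [apply: Hs | apply: Hs'].
Qed.

(* Split the parallelogram on 1, omega into two unit triangles: in each, the
   barycentric mean of the squared distances to the vertices is
   l0 l1 + l0 l2 + l1 l2 <= 1/3. *)
Lemma hexagonal_cover (R : archiRealFieldType) (x y : R) :
  exists m n : int, (x - m%:~R) ^+ 2 + (x - m%:~R) * (y - n%:~R)
                    + (y - n%:~R) ^+ 2 <= 1 / 3.
Proof.
(* [N p q] is the squared modulus of [p + q omega], with [omega] a primitive sixth root of unity. *)
pose N (p q : R) := p ^+ 2 + p * q + q ^+ 2.
have triangle p q : 0 <= p -> 0 <= q -> p + q <= 1 ->
  [\/ N p q <= 1 / 3, N (p - 1) q <= 1 / 3 | N p (q - 1) <= 1 / 3].
  move=> p0 q0 pq1; rewrite /N.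
  case: (leP (p ^+ 2 + p * q + q ^+ 2) (1 / 3)) => [|h0].
    by constructor 1.
  case: (leP ((p - 1) ^+ 2 + (p - 1) * q + q ^+ 2) (1 / 3)) => [|h1].
    by constructor 2.
  constructor 3; rewrite leNgt; apply/negP => h2.
  have l0 : 0 <= 1 - p - q by lra.
  pose e := Num.min (N p q) (Num.min (N (p - 1) q) (N p (q - 1))).
  have e0 : 1 / 3 < e by rewrite /e !lt_min h0 h1 h2.
  have le_e0 : e <= N p q by rewrite /e ge_min lexx.
  have le_e1 : e <= N (p - 1) q by rewrite /e !ge_min lexx orbT.
  have le_e2 : e <= N p (q - 1) by rewrite /e !ge_min lexx !orbT.
  have := ler_wpM2l l0 le_e0; have := ler_wpM2l p0 le_e1.
  have := ler_wpM2l q0 le_e2; rewrite /N.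
  have := sqr_ge0 (p - q); have := sqr_ge0 (1 - p - q - p).
  have := sqr_ge0 (1 - p - q - q); lra.
have /andP[mx xm] := floor_itv x; have /andP[ny yn] := floor_itv y.
rewrite !rmorphD /= in xm yn.
pose m := Num.floor x; pose n := Num.floor y.
pose p := x - m%:~R; pose q := y - n%:~R.
have p0 : 0 <= p by rewrite /p /m; lra.
have q0 : 0 <= q by rewrite /q /n; lra.
have [pq1|pq1] := leP (p + q) 1.
  have [le3|le3|le3] := triangle p q p0 q0 pq1.
  - by exists m, n.
  - exists (m + 1), n; move: le3.
    by rewrite /N /p rmorphD /= opprD addrA.
  - exists m, (n + 1); move: le3.
    by rewrite /N /q rmorphD /= opprD addrA.
have p'0 : 0 <= 1 - p by rewrite /p /m; lra.
have q'0 : 0 <= 1 - q by rewrite /q /n; lra.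
(* A half turn about the centre of the parallelogram maps the upper triangle to the lower one. *)
have [|le3|le3|le3] := triangle (1 - p) (1 - q) p'0 q'0; first lra.
- by exists (m + 1), (n + 1); move: le3; rewrite /N /p /q !rmorphD /=; lra.
- by exists m, (n + 1); move: le3; rewrite /N /p /q !rmorphD /=; lra.
- by exists (m + 1), n; move: le3; rewrite /N /p /q !rmorphD /=; lra.
Qed.

(** * Gaussian and Eisenstein integers *)

Lemma imquad_valD (R : realType) (d : nat) :
  {morph @imquad_val R d : x y / x + y}.
Proof. exact: (rmorphD (\val : imquad R d -> R[i])). Qed.

Lemma imquad_valM (R : realType) (d : nat) :
  {morph @imquad_val R d : x y / x * y}.
Proof. by []. Qed.

Definition complex_integers (R : realType) (d : nat) : set R[i] :=
  @imquad_val R d @` integers R d.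
Arguments complex_integers : clear implicits.

Lemma complex_integersB (R : realType) d z w :
  complex_integers R d z -> complex_integers R d w ->
  complex_integers R d (z - w).
Proof.
move=> [x intx <-] [y inty <-]; exists (x - y); first exact: integral_sub.
exact: (rmorphB (\val : imquad R d -> R[i])).
Qed.

Lemma complex_integersM (R : realType) d z w :
  complex_integers R d z -> complex_integers R d w ->
  complex_integers R d (z * w).
Proof.
move=> [x intx <-] [y inty <-]; exists (x * y); first exact: integral_mul.
exact: imquad_valM.
Qed.

(** Constant term 1 suffices for the generators: [t] is 2 for the element 1, 0 for the square root
    of -1, and 1 for the sixth root of unity. *)
Lemma complex_integers_quadratic (R : realType) d (z : R[i]) (t : int) :
  z \in quadratic R d -> z ^+ 2 - t%:~R * z + 1 = 0 -> complex_integers R d z.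
Proof.
move=> Qz z2; exists (ImQuad Qz) => //.
exists (Poly [:: 1; - t; 1]).
  by apply/monicP; rewrite lead_coefE (@PolyK _ 0).
rewrite -(fmorph_root (\val : imquad R d -> R[i])) -map_poly_comp.
rewrite (eq_map_poly (fun=> rmorph_int _ _)) map_Poly rootE horner_Poly /=.
apply/eqP; rewrite -[RHS]z2 rmorphN /=.
ring.
Qed.

Lemma complex_integers1 (R : realType) d : complex_integers R d 1.
Proof.
apply: (@complex_integers_quadratic _ _ _ 2); last by ring.
by apply/asboolP; exists 1, 0; rewrite rmorph1 rmorph0 mul0r addr0.
Qed.

Lemma euclidean_gauss (R : realType) : euclidean (complex_integers R 1) (1 / 2).
Proof.
have [y sE y2] := sqrtCN_natr R (isT : 0 < 1)%N.
have y0 : y != 0 by rewrite -sqrf_eq0 y2 oner_eq0.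
apply: (@quadratic_lattice_euclidean _ _ _ 0 y) => //.
- lra.
- exact: complex_integers1.
- apply: (@complex_integers_quadratic _ _ _ 0).
    by apply/asboolP; exists 0, 1; rewrite rmorph0 rmorph1 add0r mul1r sE.
  by rewrite -sE mul0r subr0 sqrtCK addNr.
- exact: complex_integersB.
- exact: complex_integersM.
- by move=> z; apply: normsq_integer.
case=> a b; have [m le_m] := int_near a; have [n le_n] := int_near (b / y).
exists m, n.
have toC (j : int) : (j%:~R : R[i]) = (j%:~R +i* 0)%C.
  by rewrite -(rmorph_int (real_complex R)).
rewrite normsqE !toC; simpc => /=.
have -> : (b - n%:~R * y) = (b / y - n%:~R) * y by rewrite mulrBl divfK.
by rewrite [(_ * y) ^+ 2]exprMn y2; lra.
Qed.

Lemma euclidean_eisenstein (R : realType) :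
  euclidean (complex_integers R 3) (1 / 3).
Proof.
have [y sE y2] := sqrtCN_natr R (isT : 0 < 3)%N.
have y0 : y != 0 by rewrite -sqrf_eq0 y2 pnatr_eq0.
have tE : (2^-1 +i* (y / 2))%C = 2^-1 + 2^-1 * sqrtC (- 3%:R) :> R[i].
  have -> : (2^-1 : R[i]) = (2^-1 +i* 0)%C.
    by rewrite -(rmorph_nat (real_complex R)) -fmorphV.
  by rewrite sE; simpc; congr Complex; ring.
apply: (@quadratic_lattice_euclidean _ _ _ 2^-1 (y / 2)) => //.
- by rewrite mulf_neq0 // invr_eq0 pnatr_eq0.
- lra.
- exact: complex_integers1.
- apply: (@complex_integers_quadratic _ _ _ 1).
    apply/asboolP; exists 2^-1, 2^-1.
    by rewrite tE fmorphV rmorph_nat.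
  rewrite tE; have := sqrtCK (- 3%:R : R[i]); set s := sqrtC _ => s2.
  by field: s2.
- exact: complex_integersB.
- exact: complex_integersM.
- by move=> z; apply: normsq_integer.
(* The coordinates of [a + i b] in the basis 1, [(1 + i y) / 2] are [a - q / 2] and [q]. *)
case=> a b; pose q := 2 * b / y.
have [m [n le3]] := hexagonal_cover (a - q / 2) q.
exists m, n.
have toC (j : int) : (j%:~R : R[i]) = (j%:~R +i* 0)%C.
  by rewrite -(rmorph_int (real_complex R)).
rewrite normsqE !toC; simpc => /=.
have -> : (b - n%:~R * (y / 2)) = (q - n%:~R) / 2 * y.
  by rewrite /q; field.
rewrite [(_ * y) ^+ 2]exprMn y2.
lra.
Qed.

(** * Free lattices and their endomorphisms *)

(** The ideal is generated by some [g], so [Q] is [P] times the diagonal matrix with entries 1 and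
    [g]. *)
Lemma lattice_basis (R : realType) (d : nat) rho (P : 'M[R[i]]_2)
    (I : set (imquad R d)) :
  euclidean (complex_integers R d) rho -> P \in unitmx ->
  fractional_ideal (integers R d) I ->
  exists2 Q : 'M[R[i]]_2, Q \in unitmx &
    forall w, lattice P I w <->
      exists2 a, intvec (complex_integers R d) a & w = Q *m a.
Proof.
move=> E Pu [I0 ID IM [x0 Ix0 x0N0] [c [Oc cN0 Ic]]].
have val_neq0 (x : imquad R d) : x != 0 -> imquad_val x != 0.
  by rewrite -(fmorph_eq0 (\val : imquad R d -> R[i])).
have [|||||_ [[g Ig <-] g0 gP]] := @euclidean_principal _ _ _
    (@imquad_val R d @` I) (imquad_val c) E.
- move=> _ _ [x Ix <-] [y Iy <-]; exists (x + y); first exact: ID.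
  exact: imquad_valD.
- move=> _ _ [a Oa <-] [x Ix <-]; exists (a * x); first exact: IM.
  exact: imquad_valM.
- by exists (imquad_val x0); [exists x0 | exact: val_neq0].
- exact: val_neq0.
- move=> _ [x Ix <-]; exists (c * x); first exact: Ic.
  exact: imquad_valM.
pose D : 'M[R[i]]_2 := diag_mx (\row_i [:: 1; imquad_val g]`_i).
have DE a : D *m a = \col_i [:: a 0 0; imquad_val g * a 1 0]`_i.
  by apply: col2P; rewrite mul_diag_mx !mxE /= ?mul1r.
exists (P *m D).
  rewrite unitmx_mul Pu unitmxE det_diag big_ord_recl big_ord1 !mxE /= mul1r.
  by rewrite unitfE.
move=> w; split=> [[a [b [Oa Ib ->]]]|[a Oa ->]].
  have [k Ok bE] := gP (imquad_val b) (ex_intro2 _ _ b Ib erefl).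
  exists (\col_i [:: imquad_val a; k]`_i).
    by elim/ord2_ind; rewrite mxE //=; exists a.
  rewrite -mulmxA DE !mxE /=; congr (_ *m _).
  by apply: col2P; rewrite !mxE //= bE mulrC.
have [[p Op pE] [q Oq qE]] := (Oa 0, Oa 1).
exists p, (q * g); split; [by [] | exact: IM |].
rewrite -mulmxA DE -pE -qE; congr (_ *m _); apply: col2P; rewrite !mxE //=.
by rewrite mulrC; exact: imquad_valM.
Qed.

Section LatticeEndomorphisms.

Variables (R : realType) (d : nat) (rho : R).
Local Notation O := (complex_integers R d).
Variables (Q : 'M[R[i]]_2) (L : set 'cV[R[i]]_2).
Hypothesis E : euclidean O rho.
Hypothesis Qu : Q \in unitmx.
Hypothesis LE : forall w, L w <-> exists2 a, intvec O a & w = Q *m a.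

Let endo : set 'M[R[i]]_2 := [set X | forall w, L w -> L (X *m w)].

Lemma int_dot a b : intvec O a -> intvec O b -> O ((a^T *m b) 0 0).
Proof.
by move=> Oa Ob; rewrite mxE sum2 !mxE; apply: (euclidD E); apply: (euclidM E).
Qed.

(** Column [j] holds the coordinates, in the basis of columns of [Q], of the image under [X] of the
    [j]-th basis vector. *)
Lemma endo_int X i j : endo X -> O ((invmx Q *m X *m Q) i j).
Proof.
move=> SX; have /SX/LE[a Oa XE] : L (Q *m delta_mx j 0).
  apply/LE; exists (delta_mx j 0) => // k; rewrite mxE eqxx andbT.
  by case: (k == j); [exact: euclid1 E | exact: euclid0 E].
suff -> : (invmx Q *m X *m Q) i j = a i 0 by [].
by rewrite -[a](mulKmx Qu) -XE !mulmxA -colE [RHS]mxE.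
Qed.

Lemma endo_det X : \det (invmx Q *m X *m Q) = \det X.
Proof.
by rewrite !det_mulmx det_inv mulrAC mulVf ?mul1r.
Qed.

Lemma dualvec_dual b : intvec O b -> dual_lattice d L (dualvec Q b).
Proof.
by move=> Ob _ /LE[a Oa ->]; rewrite herm_dualvec //; exact: int_dot.
Qed.

Lemma endo_rank1 X : endo X -> \det X = 0 ->
  exists a b, [/\ intvec O a, intvec O b & X = tensor (Q *m a) (dualvec Q b)].
Proof.
move=> SX detX; have [|a [b [Oa Ob XE]]] :=
    integral_rank1 E (fun i j => endo_int i j SX).
  by rewrite endo_det.
exists a, b; split=> //; rewrite tensor_dualvec.
by rewrite -[_ *m b^T]mulmxA -XE !mulmxA mulmxV // mul1mx mulmxK.
Qed.

Lemma tensor_rank_endo X : endo X -> \det X = 0 -> tensor_rank d L X 1.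
Proof.
move=> SX detX; have [a [b [Oa Ob XE]]] := endo_rank1 SX detX.
split=> //; exists (fun=> Q *m a), (fun=> dualvec Q b).
split=> [_|_|]; [by apply/LE; exists a | exact: dualvec_dual |].
by rewrite big_ord1.
Qed.

Lemma frobsq_endo_ge2 X : endo X -> \det X != 0 -> 2 <= frobsq X.
Proof.
move=> SX detX; apply: frobsq_ge2; apply: (euclid_ge1 E) => //.
have O' i j := endo_int i j SX.
rewrite -endo_det det2E.
by apply: (euclidB E); apply: (euclidM E).
Qed.

(* For u = Q a shortest in L, the vector dualvec Q (perp a) is shortest in the
   dual lattice, of squared norm ||u||^2 / |det Q|^2; their
   tensor is nilpotent. *)
Lemma shortest_nilpotent : exists Y,
  [/\ endo Y, Y != 0, \det Y = 0, frobsq Y * (1 - rho) <= 1 &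
   forall X, endo X -> X != 0 -> \det X = 0 -> frobsq Y <= frobsq X].
Proof.
have [a [Oa a0 min_a]] := shortest_vector E Qu.
have le_a := shortest_vector_le E Qu Oa a0 min_a.
have Opa := intvec_perp E Oa.
have D0 : 0 < normsq (\det Q) by rewrite normsq_gt0 -unitfE -unitmxE.
have vN (u : 'cV[R[i]]_2) : vnormsq (- u) = vnormsq u.
  by rewrite /vnormsq !mxE !normsqN.
pose Y := tensor (Q *m a) (dualvec Q (perp a)).
have frobY : frobsq Y = vnormsq (Q *m a) ^+ 2 / normsq (\det Q).
  by rewrite frobsq_tensor vnormsq_dualvec // perpK mulmxN vN mulrA expr2.
have YE : Y = Q *m (a *m (perp a)^T *m invmx Q).
  by rewrite /Y tensor_dualvec !mulmxA.
exists Y; split.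
(* [Y] sends [Q *m b] to an integral multiple of [Q *m a]. *)
- move=> _ /LE[b Ob ->]; apply/LE; exists (((perp a)^T *m b) 0 0 *: a).
    by move=> i; rewrite mxE; apply: (euclidM E) => //; exact: int_dot.
  rewrite YE -!mulmxA mulKmx // -scalemxAr -mul_mx_scalar.
  by rewrite mulmxA; congr (_ *m _); exact: mx11_scalar.
- apply/eqP => Y0; have : 0 < frobsq Y.
    by rewrite frobY divr_gt0 // exprn_gt0 //
      lt0r vnormsq_ge0 vnormsq_eq0 (unitmx_mul_eq0 _ Qu) a0.
  by rewrite Y0 /frobsq /vnormsq !mxE normsq0 !addr0 ltxx.
- rewrite YE !det_mulmx; suff -> : \det (a *m (perp a)^T) = 0.
    by rewrite mul0r mulr0.
  by rewrite det2E !mxE !big_ord1 !mxE /=; ring.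
- by rewrite frobY mulrAC ler_pdivrMr // mul1r.
move=> X SX X0 detX; have [b [e [Ob Oe XE]]] := endo_rank1 SX detX.
(* Both factors of the norm of [X] are lengths of nonzero lattice vectors, [Q *m b] and
   [Q *m perp e], so each is at least that of [Q *m a]. *)
rewrite frobY XE frobsq_tensor vnormsq_dualvec // mulrA expr2.
rewrite ler_pM2r ?invr_gt0 // ler_pM ?vnormsq_ge0 // min_a //.
- by apply: contra X0 => /eqP b0; rewrite XE b0 mulmx0 /tensor mul0mx.
- exact: intvec_perp E Oe.
- rewrite perp_eq0; apply: contra X0 => /eqP e0.
  by rewrite XE tensor_dualvec e0 trmx0 mulmx0 mul0mx.
Qed.

End LatticeEndomorphisms.

Theorem proposition8 (R : realType) (d : nat) (hd : d = 1%N \/ d = 3%N)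
    (A : falgType (imquad R d)) (hA : central_simple A)
    (iso : exists f : {lrmorphism A -> 'M[imquad R d]_2}, bijective f)
    (Lambda : set A) (hLambda : maximal_order (integers R d) Lambda)
    (phi : {lrmorphism A -> 'M[R[i]]_2 | @imquad_val R d \; *:%R})
    (phi_inj : injective phi)
    (P : 'M[R[i]]_2) (hP : P \in unitmx)
    (I : set (imquad R d)) (hI : fractional_ideal (integers R d) I)
    (L : set 'cV[R[i]]_2) (hL : L = lattice P I)
    (hphi : phi @` Lambda = [set M | forall w, L w -> L (M *m w)]) :
  (d = 1%N ->
     exists2 x, smallest_nonzero (phi @` Lambda) x & tensor_rank d L x 1) /\
  (d = 3%N ->
     forall x, smallest_nonzero (phi @` Lambda) x -> tensor_rank d L x 1).
Proof.
rewrite hphi; split=> d_eq.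
  have E : euclidean (complex_integers R d) (1 / 2).
    by rewrite d_eq; exact: euclidean_gauss.
  have [Q Qu LE] := lattice_basis E hP hI; rewrite -hL in LE.
  have [Y [SY Y0 detY frobY minY]] := shortest_nilpotent E Qu LE.
  exists Y; last exact: (tensor_rank_endo E Qu LE).
  split=> // X SX X0; rewrite le_frobenius.
  have [detX|detX] := eqVneq (\det X) 0; first exact: minY.
  (* With [rho = 1/2] both bounds equal 2, so a tie with an invertible element is not excluded; the
     weak inequality still makes [Y] smallest. *)
  by have := frobsq_endo_ge2 E Qu LE SX detX; lra.
have E : euclidean (complex_integers R d) (1 / 3).
  by rewrite d_eq; exact: euclidean_eisenstein.
have [Q Qu LE] := lattice_basis E hP hI; rewrite -hL in LE.
move=> X [SX X0 minX]; apply: (tensor_rank_endo E Qu LE) => //.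
apply/eqP; apply: contraT => detX.
have [Y [SY Y0 detY frobY _]] := shortest_nilpotent E Qu LE.
(* With [rho = 1/3] the squared norm of [Y] is at most 3/2, strictly below the bound 2 for an
   invertible [X]. *)
have := minX _ SY Y0; rewrite le_frobenius.
by have := frobsq_endo_ge2 E Qu LE SX detX; lra.
Qed.
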